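(* For all integers $1\le d\le n$, the hyperbolicity cone with respect to $\mathbf{1}=(1,\dots,1)\in\mathbb{R}^n$ of the elementary symmetric polynomial $$e_d(\mathbf{x})=\sum_{\substack{S\subseteq\{1,\dots,n\}\\|S|=d}}\ \prod_{i\in S}x_i\in\mathbb{R}[x_1,\dots,x_n]$$ is spectrahedral.
   Context: A homogeneous polynomial $h\in\mathbb{R}[x_1,\dots,x_n]$ is hyperbolic with respect to $\mathbf{e}\in\mathbb{R}^n$ if $h(\mathbf{e})\neq 0$ and for every $\mathbf{x}\in\mathbb{R}^n$ the univariate polynomial $t\mapsto h(t\mathbf{e}-\mathbf{x})$ has only real zeros. Its hyperbolicity cone with respect to $\mathbf{e}$ is $\Lambda_+(h,\mathbf{e})=\{\mathbf{x}\in\mathbb{R}^n : \text{all zeros of } t\mapsto h(t\mathbf{e}-\mathbf{x}) \text{ are} \geq 0\}$. The polynomials $e_d$ are hyperbolic with respect to $\mathbf{1}$. A convex cone in $\mathbb{R}^n$ is spectrahedral if it is of the form $\{\mathbf{x}\in\mathbb{R}^n:\sum_{i=1}^n x_iA_i \text{ is positive semidefinite}\}$, where $A_1,\dots,A_n$ are real symmetric matrices of the same size such that $\sum_{i=1}^n y_iA_i$ is positive definite for some $(y_1,\dots,y_n)\in\mathbb{R}^n$. *)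

(* Defs.v *)
From mathcomp Require Import all_boot all_order all_algebra.
From mathcomp Require Import classical_sets reals.
From mathcomp Require Import complex.
From mathcomp Require Import mpoly.

Set Implicit Arguments.
Unset Strict Implicit.
Unset Printing Implicit Defensive.

Import Order.TTheory GRing.Theory Num.Theory.
Local Open Scope classical_set_scope.
Local Open Scope ring_scope.

(* The univariate polynomial t |-> h (t e - x). *)
Definition pencil (R : realType) (n : nat) (h : {mpoly R[n]})
    (e x : 'rV[R]_n) : {poly R} :=
  mmap polyC (fun i => e 0 i *: 'X - (x 0 i)%:P) h.

(* The zeros range over the complex numbers: for z : R[i], 0 <= z means that
   z is real and nonnegative. *)
Definition hyperbolicity_cone (R : realType) (n : nat) (h : {mpoly R[n]})
    (e : 'rV[R]_n) : set 'rV[R]_n :=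
  [set x | forall z : R[i],
     root (map_poly (real_complex R) (pencil h e x)) z -> 0 <= z].

Definition posdefmx (R : realType) (m : nat) (A : 'M[R]_m) : Prop :=
  A \is symmetricmx /\ forall v : 'cV[R]_m, v != 0 -> 0 < (v^T *m A *m v) 0 0.

Definition possemidefmx (R : realType) (m : nat) (A : 'M[R]_m) : Prop :=
  A \is symmetricmx /\ forall v : 'cV[R]_m, 0 <= (v^T *m A *m v) 0 0.

(* A set of this form is automatically a convex cone. *)
Definition spectrahedral (R : realType) (n : nat) (C : set 'rV[R]_n) : Prop :=
  exists (m : nat) (A : 'I_n -> 'M[R]_m.+1),
    [/\ forall i, A i \is symmetricmx,
        exists y : 'rV[R]_n, posdefmx (\sum_(i < n) y 0 i *: A i) &
        C = [set x | possemidefmx (\sum_(i < n) x 0 i *: A i)]].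

(* Main.v *)
Require Import Defs.
From mathcomp Require Import all_boot all_order all_algebra.
From mathcomp Require Import classical_sets reals.
From mathcomp Require Import mpoly.
From mathcomp Require Import complex finset ring lra.

(* Writing e_k(S) for the elementary symmetric polynomial in the variables x_i
   with i in S, the quotients q_k(S) = e_k(S) / e_(k-1)(S) satisfy
     q_k(S) = 1/k \sum_(i in S) 1 / (1 / x_i + 1 / q_(k-1)(S \ i)),
   the effective conductance of a star whose i-th branch is a resistor of
   conductance x_i in series with a network of conductance q_(k-1)(S \ i).
   Unfolding this recursion gives a tree-shaped network, indexed by words
   without repeated letters, whose energy is a quadratic form with coefficients
   linear in x. It is definite when x = 1, and eliminating its nodes one after the
   other, from the leaves to the root, shows that it is semidefinite exactly on
   the cone. For this one needs that the cone is described by e_j(x + t 1) > 0 for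
   all j <= d and t > 0, and that the inequalities e_j(S) > 0, j <= k, imply
   e_j(S \ i) > 0, j < k. Both follow from Gauss-Lucas: the polynomials
   e_k(x + t 1) are, up to positive factors, iterated t-derivatives of
   \prod_i (x_i + t), hence real-rooted, which also yields Newton's inequality
   e_k ^ 2 >= e_(k-1) e_(k+1). *)

Set Implicit Arguments.
Unset Strict Implicit.
Unset Printing Implicit Defensive.

Import Order.TTheory GRing.Theory Num.Theory.
Local Open Scope ring_scope.

Lemma setD1_ind (I : finType) (P : {set I} -> Prop) :
  P set0 -> (forall (S : {set I}) i, i \in S -> P (S :\ i) -> P S) -> forall S, P S.
Proof.
move=> P0 PS S; move cS: #|S| => m; elim: m S cS => [|m IHm] S cS.
  by rewrite (cards0_eq cS).
have [i iS] : exists i, i \in S by apply/set0Pn; rewrite -card_gt0 cS.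
by apply: (PS _ i iS); apply: IHm; apply/eqP; rewrite -eqSS -cS (cardsD1 i S) iS.
Qed.

(** * Elementary symmetric polynomials *)

Section ElementarySymmetric.

(** Read off the generating product, so that the index set may vary and identities become
    comparisons of coefficients; the value is 0 for [k > #|S|]. *)
Definition elsym (K : comNzRingType) (I : finType) (a : I -> K) (S : {set I})
    (k : nat) : K := (\prod_(i in S) (1 + a i *: 'X))`_k.

Variables (K : comNzRingType) (I : finType).
Implicit Types (a : I -> K) (S : {set I}).

Lemma eq_elsym a b S k : a =1 b -> elsym a S k = elsym b S k.
Proof.
move=> eq_ab; rewrite /elsym; congr ((polyseq _)`_k).
by apply: eq_bigr => i _; rewrite eq_ab.
Qed.

Lemma elsym_rmorph (L : comNzRingType) (f : {rmorphism K -> L}) a S k :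
  f (elsym a S k) = elsym (f \o a) S k.
Proof.
rewrite /elsym -coef_map rmorph_prod; congr ((polyseq _)`_k); apply: eq_bigr => i _.
by rewrite rmorphD rmorph1 -!mul_polyC rmorphM /= map_polyC map_polyX.
Qed.

Lemma elsymD1 a S i k : i \in S ->
  elsym a S k.+1 = a i * elsym a (S :\ i) k + elsym a (S :\ i) k.+1.
Proof.
move=> iS; rewrite /elsym (big_setD1 i iS) /= mulrDl mul1r coefD addrC.
by rewrite -scalerAl coefZ coefXM.
Qed.

Lemma elsym0 a S : elsym a S 0 = 1.
Proof.
rewrite /elsym -horner_coef0 horner_prod big1 // => i _.
by rewrite !hornerE.
Qed.

Lemma elsym_set0 a k : elsym a set0 k.+1 = 0.
Proof. by rewrite /elsym big_set0 coef1. Qed.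

Lemma elsym_gt a S k : (#|S| < k)%N -> elsym a S k = 0.
Proof.
elim/setD1_ind: S k => [|S i iS IHS] [|k] //; first by rewrite elsym_set0.
rewrite (cardsD1 i S) iS => Sk.
by rewrite (elsymD1 _ _ iS) !IHS ?mulr0 ?addr0 // ltnW.
Qed.

Lemma elsym_top a S : elsym a S #|S| = \prod_(i in S) a i.
Proof.
elim/setD1_ind: S => [|S i iS IHS]; first by rewrite cards0 elsym0 big_set0.
rewrite (cardsD1 i S) iS (elsymD1 _ _ iS) IHS [elsym _ _ _.+1]elsym_gt //.
by rewrite addr0 -big_setD1.
Qed.

Lemma elsymN a S k : elsym (fun i => - a i) S k = (-1) ^+ k * elsym a S k.
Proof.
elim/setD1_ind: S k => [|S i iS IHS] [|k]; rewrite ?elsym0 ?mul1r //.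
  by rewrite !elsym_set0 mulr0.
by rewrite !(elsymD1 _ _ iS) !IHS // exprS; ring.
Qed.

Lemma deriv_prod (F : I -> {poly K}) S :
  (\prod_(i in S) F i)^`() = \sum_(i in S) (F i)^`() * \prod_(j in S :\ i) F j.
Proof.
elim/setD1_ind: S => [|S i iS IHS]; first by rewrite !big_set0 derivC.
rewrite (big_setD1 i iS) /= derivM IHS [RHS](big_setD1 i iS) /=; congr (_ + _).
rewrite big_distrr; apply: eq_bigr => j /setD1P[ji jS].
have iSj : i \in S :\ j by rewrite !inE eq_sym ji.
by rewrite [in RHS](big_setD1 i iSj) /= mulrCA !setDDl setUC.
Qed.

(** Both sides are the coefficient of ['X^k] in the derivative of the generating product. *)
Lemma elsym_Euler a S k :
  \sum_(i in S) a i * elsym a (S :\ i) k = k.+1%:R * elsym a S k.+1.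
Proof.
rewrite /elsym mulr_natl -coef_deriv deriv_prod coef_sum; apply: eq_bigr => i _.
by rewrite derivD derivC add0r derivZ derivX -mulr_algl -mulrA mul1r mulr_algl coefZ.
Qed.

Lemma elsym1 a S : elsym a S 1 = \sum_(i in S) a i.
Proof.
have := elsym_Euler a S 0; rewrite mulr1n mul1r => <-.
by apply: eq_bigr => i _; rewrite elsym0 mulr1.
Qed.

End ElementarySymmetric.

Lemma mmap_mesym (R K : comNzRingType) (n d : nat) (f : {rmorphism R -> K})
    (a : 'I_n -> K) :
  mmap f a (mesym n R d) = elsym a setT d.
Proof.
have -> : elsym a setT d =
    \sum_(A : {set 'I_n} | #|A| == d) \prod_(i in A) a i.
  rewrite /elsym (eq_bigl xpredT) => [|i]; last by rewrite inE.
  under eq_bigr do rewrite addrC.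
  rewrite bigA_distr coef_sum [RHS]big_mkcond /=; apply: eq_bigr => A _.
  rewrite -big_mkcond /=.
  under eq_bigr do rewrite -mul_polyC.
  rewrite big_split /= prodr_const -rmorph_prod mul_polyC coefZ coefXn.
  by rewrite eq_sym; case: eqP => _; rewrite ?mulr1 ?mulr0.
rewrite mesymE raddf_sum; apply: eq_bigr => A _ /=.
rewrite mmapX /mmap1 [RHS]big_mkcond; apply: eq_bigr => i _.
by rewrite mnmE; case: (i \in A).
Qed.

(** * Real-rooted polynomials *)

Section RealRooted.

Variable R : rcfType.
Implicit Types (b r c : R) (s : seq R) (p : {poly R}).

(** Positivity of [c] makes [p] positive to the right of [b]; the bound [b] is what differentiation
    preserves. *)
Definition splits_le b m p : Prop :=
  exists2 c, 0 < c & exists2 s, size s = m /\ all (<= b) s &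
    p = c *: \prod_(r <- s) ('X - r%:P).

(* A zero [z] of the derivative is the mean of the zeros [r] weighted by
   |z - r|^-2, hence real and at most [b] in the order of [R[i]]. *)
Lemma deriv_root_le b s (z : R[i]) : s != [::] -> all (<= b) s ->
  root (map_poly (real_complex R) (\prod_(r <- s) ('X - r%:P))^`()) z ->
  z <= real_complex R b.
Proof.
have mapE t : map_poly (real_complex R) (\prod_(r <- t) ('X - r%:P)) =
    \prod_(r <- t) ('X - (real_complex R r)%:P).
  by rewrite rmorph_prod; apply: eq_bigr => r _; rewrite /= map_polyXsubC.
move=> s0 sb; rewrite -deriv_map mapE.
have [/hasP[r rs /eqP ->] _|] := boolP (has (fun r => z == real_complex R r) s).
  by rewrite lecR; exact: (allP sb).
rewrite -all_predC => /allP /= zs.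
have log_deriv t : {subset t <= s} ->
    (\prod_(r <- t) ('X - (real_complex R r)%:P))^`().[z] =
    (\prod_(r <- t) ('X - (real_complex R r)%:P)).[z] *
      \sum_(r <- t) (z - real_complex R r)^-1.
  elim: t => [|r t IHt] ts; first by rewrite !big_nil derivC !hornerE.
  have zr : z - real_complex R r != 0 by rewrite subr_eq0 zs ?ts ?mem_head.
  rewrite !big_cons derivM derivXsubC mul1r hornerD !hornerM IHt; last first.
    by move=> q qt; apply: ts; rewrite inE qt orbT.
  by rewrite hornerXsubC; field.
rewrite rootE log_deriv // mulf_eq0 => /orP[|].
  rewrite horner_prod prodf_seq_eq0 => /hasP[r rs].
  by rewrite /= hornerXsubC subr_eq0 (negbTE (zs r rs)).
pose w r := `|z - real_complex R r| ^- 2.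
have w_gt0 r : r \in s -> 0 < w r.
  by move=> rs; rewrite invr_gt0 exprn_gt0 // normr_gt0 subr_eq0 zs.
move=> /eqP sum0.
(* Conjugation turns [w r * (z - r)] into [(z - r)^-1], so this is the conjugate of [sum0]. *)
have wz : \sum_(r <- s) w r * (z - real_complex R r) = 0.
  apply: (can_inj conjCK); rewrite [RHS]rmorph0 -[RHS]sum0 raddf_sum.
  apply: eq_bigr => r _.
  have w_real : w r \is Num.real by rewrite ger0_real // invr_ge0 exprn_ge0.
  by rewrite /= rmorphM [RHS]invC_norm /= (conj_Creal w_real).
have W_gt0 : 0 < \sum_(r <- s) w r.
  case: s s0 w_gt0 {sb zs log_deriv sum0 wz} => // r s _ w_gt0.
  rewrite big_cons ltr_wpDr ?w_gt0 ?mem_head // big_seq sumr_ge0 // => q qs.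
  by rewrite ltW // w_gt0 // inE qs orbT.
rewrite -(ler_pM2l W_gt0) -subr_ge0.
rewrite -[X in _ <= X]addr0 -[X in _ <= _ + X]wz !mulr_suml -sumrB -big_split /=.
rewrite big_seq sumr_ge0 // => r rs.
have -> : w r * real_complex R b - w r * z + w r * (z - real_complex R r) =
  w r * (real_complex R b - real_complex R r) by ring.
by rewrite mulr_ge0 ?(ltW (w_gt0 r rs)) // subr_ge0 lecR; exact: (allP sb).
Qed.

Lemma deriv_splits_le b m p : splits_le b m.+1 p -> splits_le b m p^`().
Proof.
case=> c c0 [s [ss sb] ->]; rewrite derivZ.
set P := \prod_(r <- s) _.
have lead_P' : (P^`())`_m = m.+1%:R.
  rewrite coef_deriv; have : P \is monic by rewrite monic_prod_XsubC.
  by rewrite monicE lead_coefE size_prod_XsubC ss /= => /eqP ->.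
have sz_P' : size P^`() = m.+1.
  apply/eqP; rewrite eqn_leq; apply/andP; split; last first.
    rewrite ltnNge; apply/negP => /leq_sizeP/(_ m (leqnn m))/eqP.
    by rewrite lead_P' pnatr_eq0.
  by rewrite -ltnS (leq_trans (lt_size_deriv _)) ?size_prod_XsubC ?ss // -size_poly_eq0
             size_prod_XsubC ss.
have [zs zsE] := closed_field_poly_normal (map_poly (real_complex R) P^`()).
have lead_P'E : lead_coef P^`() = m.+1%:R by rewrite lead_coefE sz_P'.
rewrite lead_coef_map lead_P'E in zsE.
have m0 : (m.+1%:R : R) != 0 by rewrite pnatr_eq0.
have zs_le z : z \in zs -> z <= real_complex R b.
  move=> zzs; apply: (deriv_root_le _ sb); first by rewrite -size_eq0 ss.
  by rewrite -/P zsE rootZ ?root_prod_XsubC // fmorph_eq0.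
pose s' := [seq complex.Re z | z <- zs].
(* In [R[i]], [z <= b] forces equal imaginary parts, so each zero equals its real part. *)
have zsE' : zs = [seq real_complex R r | r <- s'].
  rewrite -map_comp map_id_in // => z /zs_le; case: z => a a'.
  by rewrite lecE /= eq_sym => /andP[/eqP -> _].
have P'E : P^`() = m.+1%:R *: \prod_(r <- s') ('X - r%:P).
  apply: (@map_poly_inj _ _ (real_complex R)).
  rewrite zsE -!mul_polyC rmorphM /= map_polyC rmorph_prod zsE' big_map; congr (_ * _).
  by apply: eq_bigr => r _; rewrite /= map_polyXsubC.
exists (c * m.+1%:R); first by rewrite mulr_gt0 ?ltr0Sn.
exists s'; last by rewrite P'E scalerA.
split.
  by apply: succn_inj; rewrite -sz_P' P'E size_scale // size_prod_XsubC.
apply/allP => r rs'; rewrite /= -lecR; apply: zs_le.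
by rewrite zsE' map_f.
Qed.

Lemma splits_leZ b m p c : 0 < c -> splits_le b m (c *: p) -> splits_le b m p.
Proof.
move=> c0 [c' c'0 [s ss cpE]]; exists (c^-1 * c'); first by rewrite mulr_gt0 ?invr_gt0.
by exists s; rewrite // -scalerA -cpE scalerK // gt_eqF.
Qed.

Lemma splits_le_horner_gt0 b m p t : splits_le b m p -> b < t -> 0 < p.[t].
Proof.
case=> c c0 [s [_ sb] ->] bt; rewrite hornerZ horner_prod mulr_gt0 //.
rewrite big_seq prodr_gt0 // => r rs.
by rewrite hornerXsubC subr_gt0 (le_lt_trans _ bt) //; apply: (allP sb).
Qed.

(** Laguerre's inequality. Splitting off a linear factor, [p = F q] with [F' = 1], gives
    [p'^2 - p p'' = q^2 + F^2 (q'^2 - q q'')], whence an induction on the zeros. *)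
Lemma splits_le_Laguerre b m p : splits_le b m p ->
  p^`().[0] ^+ 2 >= p.[0] * p^`()^`().[0].
Proof.
case=> c c0 [s _ ->]; rewrite !derivZ !hornerZ.
rewrite -subr_ge0; set P := \prod_(r <- s) _.
suff : P.[0] * P^`()^`().[0] <= P^`().[0] ^+ 2.
  rewrite -(ler_pM2l (exprn_gt0 2 c0)) -subr_ge0; congr (0 <= _); ring.
rewrite {}/P; elim: s => [|r s IHs]; first by rewrite big_nil !derivC !hornerE expr0n.
have F0 := hornerXsubC r 0; have F' := derivXsubC r.
rewrite big_cons; move: ('X - r%:P) F0 F' => F F0 F'.
rewrite !(derivM, derivD, F', mul1r) !(hornerD, hornerM, F0).
(* Names follow the order of occurrence: [q1] comes from the second derivative, [q2] from the
   first. *)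
move: IHs; set q0 := _.[0]; set q1 := _.[0]; set q2 := _.[0] => IHs.
rewrite -subr_ge0.
have -> : (q0 + (0 - r) * q2) ^+ 2 - (0 - r) * q0 * (q2 + (q2 + (0 - r) * q1)) =
  q0 ^+ 2 + r ^+ 2 * (q2 ^+ 2 - q0 * q1) by ring.
by rewrite addr_ge0 ?sqr_ge0 // mulr_ge0 ?sqr_ge0 ?subr_ge0.
Qed.

Lemma splits_le_root_real b m p (z : R[i]) : splits_le b m p ->
  root (map_poly (real_complex R) p) z -> exists2 r, z = real_complex R r & root p r.
Proof.
case=> c c0 [s _ ->].
rewrite -mul_polyC rmorphM /= map_polyC rmorph_prod mul_polyC rootZ; last first.
  by rewrite /= fmorph_eq0 gt_eqF.
rewrite /root horner_prod prodf_seq_eq0 => /hasP[r rs /=].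
rewrite map_polyXsubC hornerXsubC subr_eq0 => /eqP ->; exists r => //.
by rewrite hornerM mulf_eq0 -!rootE root_prod_XsubC rs orbT.
Qed.

End RealRooted.

(** * Elementary symmetric polynomials along the direction of the all-ones vector *)

Section TranslatedElementarySymmetric.

Variables (R : rcfType) (I : finType).
Implicit Types (a : I -> R) (S : {set I}).

Definition elsym_shift a S k : {poly R} := elsym (fun i => 'X + (a i)%:P) S k.

Lemma horner_elsym_shift a S k t :
  (elsym_shift a S k).[t] = elsym (fun i => t + a i) S k.
Proof.
rewrite -/(horner_eval t _) elsym_rmorph; apply: eq_elsym => i.
by rewrite /= /horner_eval !hornerE.
Qed.

(* For [k >= #|S|] both sides vanish, the right one by truncation. *)
Lemma deriv_elsym_shift a S k :
  (elsym_shift a S k.+1)^`() = (#|S| - k)%:R * elsym_shift a S k.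
Proof.
rewrite /elsym_shift; set A := fun i => _; elim/setD1_ind: S k => [|S i iS IHS] k.
  by rewrite elsym_set0 cards0 sub0n mul0r derivC.
have A' : (A i)^`() = 1 by rewrite derivD derivX derivC addr0.
rewrite (elsymD1 _ _ iS) derivD derivM A' mul1r IHS (cardsD1 i S) iS add1n.
case: k => [|k]; first by rewrite !elsym0 derivC !subn0 -natr1; ring.
rewrite IHS subSS (elsymD1 _ _ iS).
have [km|mk] := ltnP k #|S :\ i|; first by rewrite -(subnSK km) -natr1; ring.
rewrite elsym_gt // (_ : _ - k = 0)%N; first by rewrite !mul0r !mulr0 !addr0.
by apply/eqP; rewrite subn_eq0.
Qed.

(** Differentiating [j - k] times keeps the bound [b]; the factors met on the way are positive
    because [j <= #|S|]. *)
Lemma splits_le_elsym_shift b a S j k : (k <= j <= #|S|)%N ->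
  splits_le b j (elsym_shift a S j) -> splits_le b k (elsym_shift a S k).
Proof.
case/andP=> kj; elim: j kj => [|j IHj]; first by rewrite leqn0 => /eqP ->.
rewrite leq_eqVlt => /orP[/eqP -> //|kj] jS spl; apply: IHj (ltnW jS) _ => //.
apply: (@splits_leZ _ _ _ _ (#|S| - j)%:R); first by rewrite ltr0n subn_gt0.
by rewrite scaler_nat -mulr_natl -deriv_elsym_shift; exact: deriv_splits_le.
Qed.

Lemma splits_elsym_shift a S k : (k <= #|S|)%N ->
  exists b, splits_le b k (elsym_shift a S k).
Proof.
move=> kS; pose b := \sum_(i in S) `|a i|; exists b.
apply: (@splits_le_elsym_shift _ _ _ #|S|); first by rewrite kS leqnn.
exists 1; first exact: ltr01.
exists [seq - a i | i <- enum S].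
  split; first by rewrite size_map cardE.
  apply/allP => _ /mapP[i + ->]; rewrite mem_enum => iS.
  rewrite /b (bigD1 i) //= (le_trans (ler_norm _)) // normrN lerDl sumr_ge0 //.
rewrite /elsym_shift elsym_top scale1r big_map big_enum.
by apply: eq_bigr => i _; rewrite polyCN opprK.
Qed.

(** Laguerre at 0 for [elsym_shift a S k.+2] gives [c * e1 ^+ 2 >= (c + 1) * (e0 * e2)] with
    [c = #|S| - k.+1 > 0]. *)
Lemma elsym_Newton a S k :
  elsym a S k * elsym a S k.+2 <= elsym a S k.+1 ^+ 2.
Proof.
have [kS|Sk] := leqP k.+2 #|S|; last by rewrite [X in _ * X]elsym_gt // mulr0 sqr_ge0.
have [b /splits_le_Laguerre] := splits_elsym_shift a kS.
have shift0 j : (elsym_shift a S j).[0] = elsym a S j.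
  by rewrite horner_elsym_shift; apply: eq_elsym => i; rewrite add0r.
have hornerZn (m : nat) (p : {poly R}) : (m%:R * p).[0] = m%:R * p.[0].
  by rewrite mulr_natl hornerMn mulr_natl.
rewrite deriv_elsym_shift hornerZn mulr_natl derivMn.
rewrite deriv_elsym_shift hornerMn hornerZn !shift0.
rewrite -[_ *+ (#|S| - k.+1)]mulr_natl -(subnSK (ltnW kS)) -natr1.
set c := (#|S| - k.+1)%:R; have : 0 < c :> R by rewrite ltr0n subn_gt0.
move: (elsym a S k) (elsym a S k.+1) (elsym a S k.+2) => e0 e1 e2 c0 Lag.
rewrite leNgt; apply/negP => lt12.
have : 0 < e0 * e2 by rewrite (le_lt_trans _ lt12) ?sqr_ge0.
nra.
Qed.

(** At a first failure [f0 > 0 >= f1], while [elsymD1] gives [x * f0 + f1 > 0] and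
    [x * f1 + f2 > 0]. Then [f0 * f2 > x * f0 * - f1 >= f1 ^+ 2], against Newton's inequality. *)
Lemma elsymD1_gt0 a S i k : i \in S -> (forall j, (j <= k.+1)%N -> 0 < elsym a S j) ->
  forall j, (j <= k)%N -> 0 < elsym a (S :\ i) j.
Proof.
move=> iS eS; elim=> [_|j IHj jk]; first by rewrite elsym0.
rewrite ltNge; apply/negP => f1.
have f0 := IHj (ltnW jk).
have := eS j.+2 jk; have := eS j.+1 (ltnW jk).
rewrite !(elsymD1 _ _ iS).
have := elsym_Newton a (S :\ i) j.
move: (elsym _ _ j) (elsym _ _ j.+1) (elsym _ _ j.+2) (a i) f0 f1 => f0 f1 f2 x *.
have : f0 * f2 > - x * f0 * f1 by nra.
nra.
Qed.

End TranslatedElementarySymmetric.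

(** * The hyperbolicity cone *)

Section HyperbolicityCone.

Variables (R : realType) (n d : nat).
Implicit Type x : 'rV[R]_n.

Let cone := hyperbolicity_cone (mesym n R d) (const_mx 1).

Lemma pencil_mesym x :
  pencil (mesym n R d) (const_mx 1) x = elsym_shift (fun i => - x 0 i) setT d.
Proof.
rewrite /pencil mmap_mesym; apply: eq_elsym => i.
by rewrite mxE scale1r polyCN.
Qed.

Lemma horner_pencil_mesym x t :
  (pencil (mesym n R d) (const_mx 1) x).[t] =
  (-1) ^+ d * elsym (fun i => - t + x 0 i) setT d.
Proof.
rewrite pencil_mesym horner_elsym_shift -elsymN; apply: eq_elsym => i.
by rewrite opprD opprK.
Qed.

(** A zero [r] of [elsym_shift (x 0) setT d] gives the zero [- r] of the pencil, so membership in
    the cone means that 0 bounds these zeros; the bound descends to all [j <= d]. *)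
Lemma cone_elsym_gt0 x t j : (d <= n)%N -> cone x -> 0 < t -> (j <= d)%N ->
  0 < elsym (fun i => t + x 0 i) setT j.
Proof.
move=> dn xC t0 jd; rewrite -horner_elsym_shift.
have dS : (d <= #|[set: 'I_n]|)%N by rewrite cardsT card_ord.
apply: (@splits_le_horner_gt0 _ 0 j) => //.
apply: (@splits_le_elsym_shift _ _ _ _ _ d); first by rewrite jd.
have [b [c c0 [s [ss _] pE]]] := splits_elsym_shift (x 0) dS.
exists c => //; exists s => //; split=> //; apply/allP => r rs /=.
have : cone x := xC; move=> /(_ (real_complex R (- r))).
rewrite lecR oppr_ge0; apply.
rewrite /root horner_map /= fmorph_eq0 horner_pencil_mesym opprK -horner_elsym_shift pE.
by rewrite mulf_eq0 hornerZ mulf_eq0 -rootE root_prod_XsubC rs !orbT.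
Qed.

(** All zeros of the pencil are real, and a negative one [r] would make [e_d] vanish at the shift
    [t = - r > 0]. *)
Lemma elsym_gt0_cone x : (d <= n)%N ->
  (forall t, 0 < t -> 0 < elsym (fun i => t + x 0 i) setT d) -> cone x.
Proof.
move=> dn ex z.
have dS : (d <= #|[set: 'I_n]|)%N by rewrite cardsT card_ord.
have [b] := splits_elsym_shift (fun i => - x 0 i) dS.
rewrite -pencil_mesym => /splits_le_root_real pR /pR[r ->].
rewrite lecR leNgt rootE horner_pencil_mesym mulf_eq0 signr_eq0 /= => er.
by apply/negP => r0; move: (ex (- r)); rewrite oppr_gt0 (eqP er) ltxx => /(_ r0).
Qed.

End HyperbolicityCone.

(** * The network and its energy *)

Section Network.

Variables (R : rcfType) (I : finType).
Implicit Types (x : I -> R) (S : {set I}) (w : seq I -> R).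

Fixpoint words k S : seq (seq I) :=
  if k is k'.+1 then
    [::] :: [seq i :: q | i <- enum S, q <- words k' (S :\ i)]
  else [:: [::]].

(* The energy of the network with polarised potentials. The nodes are the words
   without repeated letters, a word [q] being joined to [rcons q i] by an edge of
   conductance proportional to [x i]; the words of length [k.+1] are grounded, so
   that the potentials matter only on [words k S]. Thus [k] corresponds to the
   elementary symmetric polynomial of degree [k.+1]. *)
Fixpoint net x k S w w' : R :=
  if k is k'.+1 then
    k'.+2%:R^-1 * \sum_(i in S)
      (x i * ((w [::] - w [:: i]) * (w' [::] - w' [:: i])) +
       net x k' (S :\ i) (fun q => w (i :: q)) (fun q => w' (i :: q)))
  else \sum_(i in S) x i * (w [::] * w' [::]).

Lemma words_nil k S : [::] \in words k S.
Proof. by case: k => [|k]; rewrite inE. Qed.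

Lemma words_cons k S i q :
  (i :: q \in words k.+1 S) = (i \in S) && (q \in words k (S :\ i)).
Proof.
rewrite inE /=; apply/allpairsPdep/andP => [[j [p [jS pw [-> ->]]]]|[iS qw]].
  by rewrite -mem_enum.
by exists i, q; rewrite mem_enum.
Qed.

Lemma netC x k S w w' : net x k S w w' = net x k S w' w.
Proof.
elim: k S w w' => [|k IHk] S w w' /=; first by under eq_bigr do rewrite (mulrC (w _)).
by congr (_ * _); apply: eq_bigr => i _; rewrite IHk [_ * (w' _ - _)]mulrC.
Qed.

Lemma eq_net x y k S w1 w2 w1' w2' : x =1 y ->
  {in words k S, w1 =1 w2} -> {in words k S, w1' =1 w2'} ->
  net x k S w1 w1' = net y k S w2 w2'.
Proof.
move=> xy; elim: k S w1 w2 w1' w2' => [|k IHk] S w1 w2 w1' w2' ew ew' /=.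
  by apply: eq_bigr => i _; rewrite xy ew ?ew' ?words_nil.
congr (_ * _); apply: eq_bigr => i iS; rewrite xy.
rewrite !ew ?ew' ?words_cons ?iS ?words_nil //; congr (_ + _).
by apply: IHk => q qw; [apply: ew|apply: ew']; rewrite words_cons iS.
Qed.

Lemma net_suml (J : finType) x k S (v : J -> R) (w : J -> seq I -> R) w' :
  net x k S (fun q => \sum_j v j * w j q) w' = \sum_j v j * net x k S (w j) w'.
Proof.
elim: k S w w' => [|k IHk] S w w' /=.
  under [RHS]eq_bigr do rewrite big_distrr /=.
  rewrite [RHS]exchange_big /=; apply: eq_bigr => i _.
  by rewrite mulr_suml mulr_sumr; apply: eq_bigr => j _; ring.
under [RHS]eq_bigr do rewrite mulrCA.
rewrite -[RHS]mulr_sumr; congr (_ * _).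
under [RHS]eq_bigr do rewrite big_distrr /=.
rewrite [RHS]exchange_big /=; apply: eq_bigr => i _.
rewrite IHk -sumrB mulr_suml mulr_sumr -big_split; apply: eq_bigr => j _ /=; ring.
Qed.

(** A sum with one term; [net_shift] and [net0] likewise come from sums with two terms and with
    none. *)
Lemma netZl x k S a w w' : net x k S (fun q => a * w q) w' = a * net x k S w w'.
Proof.
rewrite (@eq_net _ x _ _ _ (fun q => \sum_(j < 1) a * w q) _ w') //.
  by rewrite (net_suml _ _ _ (fun=> a) (fun=> w)) big_ord1.
by move=> q _; rewrite big_ord1.
Qed.

Lemma net_sumx (J : finType) (v : J -> R) (x : J -> I -> R) k S w w' :
  net (fun i => \sum_j v j * x j i) k S w w' = \sum_j v j * net (x j) k S w w'.
Proof.
elim: k S w w' => [|k IHk] S w w' /=.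
  under [RHS]eq_bigr do rewrite big_distrr /=.
  rewrite [RHS]exchange_big /=; apply: eq_bigr => i _.
  by rewrite mulr_suml; apply: eq_bigr => j _; ring.
under [RHS]eq_bigr do rewrite mulrCA.
rewrite -[RHS]mulr_sumr; congr (_ * _).
under [RHS]eq_bigr do rewrite big_distrr /=.
rewrite [RHS]exchange_big /=; apply: eq_bigr => i _.
rewrite IHk mulr_suml -big_split; apply: eq_bigr => j _ /=; ring.
Qed.

Lemma net_shift x t k S w w' :
  net (fun i => t + x i) k S w w' = t * net (fun=> 1) k S w w' + net x k S w w'.
Proof.
rewrite (@eq_net _ (fun i => \sum_b (if b then t else 1) * (if b then 1 else x i))
  _ _ _ w _ w') //; last by move=> i; rewrite big_bool /= mulr1 mul1r.
by rewrite (net_sumx (fun b : bool => if b then t else 1)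
  (fun b i => if b then 1 else x i)) big_bool /= mul1r.
Qed.

Lemma net0 x k S w w' : {in words k S, w =1 fun=> 0} -> net x k S w w' = 0.
Proof.
move=> w0; rewrite (@eq_net _ x _ _ _ (fun=> \sum_(j : 'I_0) 0 * 0) _ w') //.
  by rewrite (net_suml _ _ _ (fun=> 0) (fun (_ : 'I_0) _ => 0)) big_ord0.
by move=> q /w0 ->; rewrite big_ord0.
Qed.

Lemma net_ones_ge0 k S w : 0 <= net (fun=> 1) k S w w.
Proof.
elim: k S w => [|k IHk] S w /=.
  by rewrite sumr_ge0 // => i _; rewrite mul1r -expr2 sqr_ge0.
rewrite mulr_ge0 ?invr_ge0 // sumr_ge0 // => i _.
by rewrite addr_ge0 ?IHk // mul1r -expr2 sqr_ge0.
Qed.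

(** Zero energy forces equal potentials across every edge, and [k < #|S|] lets every node be joined
    to a grounded word of length [k.+1]. *)
Lemma net_ones_eq0 k S w : (k < #|S|)%N -> net (fun=> 1) k S w w = 0 ->
  {in words k S, w =1 fun=> 0}.
Proof.
elim: k S w => [|k IHk] S w kS /=.
  under eq_bigr do rewrite mul1r -expr2.
  move/eqP; rewrite sumr_const mulrn_eq0 -leqn0 leqNgt kS sqrf_eq0 /= => /eqP w0 q.
  by rewrite inE => /eqP ->.
have term_ge0 i : 0 <= 1 * ((w [::] - w [:: i]) * (w [::] - w [:: i])) +
    net (fun=> 1) k (S :\ i) (fun q => w (i :: q)) (fun q => w (i :: q)).
  by rewrite mul1r -expr2 addr_ge0 ?sqr_ge0 ?net_ones_ge0.
move/eqP; rewrite mulf_eq0 invr_eq0 pnatr_eq0 /= psumr_eq0 // => /allP sum0.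
have w_edge i : i \in S ->
    w [::] = w [:: i] /\ {in words k (S :\ i), forall q, w (i :: q) = 0}.
  move=> iS; have := sum0 i (mem_index_enum i); rewrite iS /= mul1r -expr2.
  rewrite paddr_eq0 ?sqr_ge0 ?net_ones_ge0 // sqrf_eq0 subr_eq0 => /andP[/eqP we /eqP].
  by move/IHk => w0; split=> // q /w0; apply; rewrite -ltnS (cardsD1 i S) iS in kS *.
have [i iS] : exists i, i \in S by apply/set0Pn; rewrite -card_gt0 (leq_trans _ kS).
case=> [_|j q].
  by have [-> ->] := w_edge i iS; rewrite ?words_nil.
by rewrite words_cons => /andP[jS qw]; have [_ ->] := w_edge j jS.
Qed.

(** Elimination of the middle node [v] between [a] and [f2 / f1]. The difference is a square over
    [f1 * (a * f1 + f2)], hence valid also for negative [a]. *)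
Lemma series_conductance_le (a f1 f2 u v : R) : 0 < f1 -> 0 < a * f1 + f2 ->
  u ^+ 2 * (a * f2) / (a * f1 + f2) <= a * (u - v) ^+ 2 + v ^+ 2 * (f2 / f1).
Proof.
move=> f1_gt0 e_gt0; rewrite -subr_ge0.
have f1n : f1 != 0 by rewrite gt_eqF.
have en : a * f1 + f2 != 0 by rewrite gt_eqF.
have -> : a * (u - v) ^+ 2 + v ^+ 2 * (f2 / f1) -
    u ^+ 2 * (a * f2) / (a * f1 + f2) =
    (v * (a * f1 + f2) - u * (a * f1)) ^+ 2 / (f1 * (a * f1 + f2)).
  by field; rewrite f1n en.
by rewrite divr_ge0 ?sqr_ge0 // mulr_ge0 // ltW.
Qed.

(** The branches in parallel: by [elsym_Euler] their series conductances average to the next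
    quotient. *)
Lemma sum_series_conductance x S k (u : R) : elsym x S k != 0 ->
  k.+1%:R^-1 * \sum_(i in S) u ^+ 2 * (x i * elsym x (S :\ i) k) / elsym x S k =
  u ^+ 2 * (elsym x S k.+1 / elsym x S k).
Proof.
move=> ek; rewrite -mulr_suml -mulr_sumr elsym_Euler.
have k1 : (k.+1%:R : R) != 0 by rewrite pnatr_eq0.
by move: (k.+1%:R) k1 => c c0; field; rewrite ek.
Qed.

(** Induction bounds each branch by a single resistor to ground, whose top node [[:: i]] is then
    eliminated. *)
Lemma net_ge x k S w : (forall j, (j <= k.+1)%N -> 0 < elsym x S j) ->
  w [::] ^+ 2 * (elsym x S k.+1 / elsym x S k) <= net x k S w w.
Proof.
elim: k S w => [|k IHk] S w eS.
  by rewrite /= -mulr_suml -expr2 mulrC elsym0 divr1 elsym1.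
rewrite -sum_series_conductance ?gt_eqF ?eS // ler_wpM2l ?invr_ge0 //.
apply: ler_sum => i iS.
have fS j : (j <= k.+1)%N -> 0 < elsym x (S :\ i) j := elsymD1_gt0 iS eS (j := j).
have := eS k.+1 (leqnSn _); rewrite (elsymD1 _ _ iS) => e_gt0.
apply: le_trans (series_conductance_le _ (w [:: i]) (fS k (leqnSn _)) e_gt0) _.
by rewrite -expr2 lerD2l IHk.
Qed.

(** Assembles a star from its root and branches; the value 0 off [S] keeps the support inside the
    words. *)
Definition glue (u : R) (ws : I -> seq I -> R) S (q : seq I) : R :=
  if q is i :: q' then if i \in S then ws i q' else 0 else u.

Lemma net_glue x k S u (ws : I -> seq I -> R) :
  let w := glue u ws S in
  net x k.+1 S w w = k.+2%:R^-1 * \sum_(i in S)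
    (x i * (u - ws i [::]) ^+ 2 + net x k (S :\ i) (ws i) (ws i)).
Proof.
by rewrite /=; congr (_ * _); apply: eq_bigr => i iS; rewrite iS expr2.
Qed.

Lemma glue_supported u (ws : I -> seq I -> R) k S :
  (forall i, i \in S -> forall q, q \notin words k (S :\ i) -> ws i q = 0) ->
  forall q, q \notin words k.+1 S -> glue u ws S q = 0.
Proof.
move=> ws0 [|i q]; first by rewrite words_nil.
by rewrite words_cons /=; case: ifP => // iS; apply: ws0.
Qed.

(** Converse of [net_ge]. Testing potentials that vanish at the root controls [elsym x S k] only;
    the witness is the equilibrium potential, whose energy carries the sign of [elsym x S k.+1]. *)
Lemma net_gt0_elsym x k S : (k <= #|S|)%N ->
  (forall w, (forall q, q \notin words k S -> w q = 0) -> w [::] = 0 ->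
     (exists q, w q != 0) -> 0 < net x k S w w) ->
  0 < elsym x S k /\
  exists w, [/\ forall q, q \notin words k S -> w q = 0, w [::] = 1 &
    net x k S w w = elsym x S k.+1 / elsym x S k].
Proof.
elim: k S => [|k IHk] S kS posS.
  split; first by rewrite elsym0.
  exists (fun q => (q == [::])%:R); split=> //.
    by move=> q; rewrite inE => /negbTE ->.
  rewrite /= elsym0 divr1 elsym1.
  by apply: eq_bigr => i _; rewrite !mulr1.
have branch i : exists w, i \in S ->
    [/\ 0 < elsym x (S :\ i) k,
        forall q, q \notin words k (S :\ i) -> w q = 0, w [::] = 1 &
        net x k (S :\ i) w w = elsym x (S :\ i) k.+1 / elsym x (S :\ i) k].
  have [iS|] := boolP (i \in S); last by exists (fun=> 0).
  have kSi : (k <= #|S :\ i|)%N by rewrite -ltnS; rewrite (cardsD1 i S) iS in kS.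
  have [|ek [w [w_supp w1 wE]]] := IHk (S :\ i) kSi; last by exists w.
  move=> w w_supp w0 [q wq].
  pose ws j := if j == i then w else fun=> 0.
  have := posS (glue 0 ws S); rewrite net_glue (bigD1 i) //= big1 => [|j /andP[_ ji]].
    rewrite /ws eqxx w0 subr0 expr0n mulr0 add0r addr0 pmulr_rgt0 ?invr_gt0 //.
    apply=> //; last by exists (i :: q); rewrite /= iS eqxx.
    apply: glue_supported => j jS q'; rewrite /ws.
    by case: eqP => // ->; apply: w_supp.
  by rewrite /ws (negbTE ji) subr0 expr0n mulr0 net0 ?addr0.
have [ws wsP] := fin_all_exists branch.
(* The test potential is the equilibrium on branch [i] and 0 elsewhere, root included; its energy is
   a positive multiple of [elsym x S k.+1 / elsym x (S :\ i) k]. *)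
have ek i : i \in S -> 0 < elsym x S k.+1.
  move=> iS; have [f_gt0 ws_supp ws1 wsE] := wsP i iS.
  pose ws' j := if j == i then ws i else fun=> 0.
  have := posS (glue 0 ws' S); rewrite net_glue (bigD1 i) //= big1 => [|j /andP[_ ji]].
    rewrite /ws' eqxx ws1 sub0r sqrrN expr1n mulr1 addr0 pmulr_rgt0 ?invr_gt0 // wsE.
    rewrite (elsymD1 _ _ iS).
    have -> : x i * elsym x (S :\ i) k + elsym x (S :\ i) k.+1 =
        (x i + elsym x (S :\ i) k.+1 / elsym x (S :\ i) k) * elsym x (S :\ i) k.
      by rewrite mulrDl divfK ?gt_eqF.
    rewrite pmulr_lgt0 //; apply=> //.
      apply: glue_supported => j jS q; rewrite /ws'.
      by case: eqP => // ->; apply: ws_supp.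
    by exists [:: i]; rewrite /= iS eqxx ws1 oner_eq0.
  by rewrite /ws' (negbTE ji) subr0 expr0n mulr0 net0 ?addr0.
have [i0 i0S] : exists i, i \in S by apply/set0Pn; rewrite -card_gt0 (leq_trans _ kS).
split; first exact: ek i0S.
have en : elsym x S k.+1 != 0 by rewrite gt_eqF // (ek i0).
(* The value of [v] at [u = 1] for which the square in [series_conductance_le] vanishes. *)
pose a i := x i * elsym x (S :\ i) k / elsym x S k.+1.
exists (glue 1 (fun i q => a i * ws i q) S); split=> //.
  apply: glue_supported => i iS q; have [_ ws_supp _ _] := wsP i iS.
  by move/ws_supp ->; rewrite mulr0.
rewrite net_glue -[RHS]mul1r -[in RHS](expr1n _ 2) -sum_series_conductance //.
congr (_ * _); apply: eq_bigr => i iS; have [f_gt0 _ ws1 wsE] := wsP i iS.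
rewrite netZl netC netZl wsE ws1 /a.
move: en f_gt0; rewrite (elsymD1 _ _ iS) => en f_gt0.
by field; rewrite en gt_eqF.
Qed.

End Network.

(** * The matrix pencil *)

Section NetworkMatrix.

Variables (R : realType) (n k : nat).
Implicit Types (x : 'rV[R]_n).

Definition nodes : seq (seq 'I_n) := undup (words k setT).

(** [spectrahedral] asks for matrices of successor size; the empty word makes [nodes] nonempty. *)
Lemma size_nodes : (size nodes).-1.+1 = size nodes.
Proof. 
rewrite prednK // -has_predT; apply/hasP.
by exists [::]; rewrite // mem_undup words_nil. Qed.

Lemma ltn_node (j : 'I_((size nodes).-1.+1)) : (j < size nodes)%N.
Proof. by rewrite -[X in (_ < X)%N]size_nodes. Qed.

Definition node_ind (j : 'I_(size nodes).-1.+1) (q : seq 'I_n) : R :=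
  (nth [::] nodes j == q)%:R.

(** Gram matrix of the energy when only the edges labelled [i] conduct, with [x i = 1]. *)
Definition net_mx (i : 'I_n) : 'M[R]_((size nodes).-1.+1) :=
  \matrix_(a, b) net (fun j => (i == j)%:R) k setT (node_ind a) (node_ind b).

Definition potential (v : 'cV[R]_((size nodes).-1.+1)) (q : seq 'I_n) : R :=
  \sum_a v a 0 * node_ind a q.

Lemma net_mx_sym (u : 'I_n -> R) : \sum_i u i *: net_mx i \is symmetricmx.
Proof.
apply/is_hermitianmxP; rewrite expr0 scale1r; apply/matrixP => a b.
by rewrite !(mxE, summxE); apply: eq_bigr => i _; rewrite !mxE netC.
Qed.

Lemma net_mx_form x (v : 'cV[R]_((size nodes).-1.+1)) :
  (v^T *m (\sum_i x 0 i *: net_mx i) *m v) 0 0 =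
  net (x 0) k setT (potential v) (potential v).
Proof.
have xE : x 0 =1 fun j => \sum_i x 0 i * (i == j)%:R.
  move=> j; rewrite (bigD1 j) //= eqxx mulr1 big1 ?addr0 // => i /negbTE ->.
  by rewrite mulr0.
rewrite (@eq_net _ _ _ _ _ _ _ (potential v) _ (potential v) xE) //.
rewrite (net_sumx (x 0) (fun i j => (i == j)%:R)) mulmx_sumr mulmx_suml summxE.
apply: eq_bigr => i _; rewrite -scalemxAr -scalemxAl mxE; congr (_ * _).
rewrite (net_suml _ _ _ (fun a => v a 0) (@node_ind)) mxE.
under eq_bigr do rewrite mxE mulr_suml.
rewrite exchange_big; apply: eq_bigr => a _ /=.
rewrite netC (net_suml _ _ _ (fun b => v b 0) (@node_ind)) mulr_sumr.
by apply: eq_bigr => b _; rewrite !mxE netC; ring.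
Qed.

Lemma potential_supported v q : q \notin words k setT -> potential v q = 0.
Proof.
rewrite -mem_undup => qN; apply: big1 => a _; rewrite /node_ind.
case: eqP => [qE|]; rewrite ?mulr0 //.
by rewrite -qE mem_nth ?ltn_node in qN.
Qed.

Lemma potentialK (w : seq 'I_n -> R) : (forall q, q \notin words k setT -> w q = 0) ->
  potential (\col_j w (nth [::] nodes j)) =1 w.
Proof.
move=> w_supp q; have [|qN] := boolP (q \in words k setT); last first.
  by rewrite w_supp // potential_supported.
rewrite -mem_undup => qn; have iq : (index q nodes < (size nodes).-1.+1)%N.
  by rewrite size_nodes index_mem.
rewrite /potential (bigD1 (Ordinal iq)) //= big1 => [|j jq].
  by rewrite mxE /node_ind /= nth_index // eqxx mulr1 addr0.
rewrite /node_ind; case: eqP => [qE|]; rewrite ?mulr0 //.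
case/negP: jq; apply/eqP/val_inj.
by rewrite /= -qE index_uniq ?undup_uniq ?ltn_node.
Qed.

Lemma potential_node v (j : 'I_(size nodes).-1.+1) :
  potential v (nth [::] nodes j) = v j 0.
Proof.
rewrite /potential (bigD1 j) //= big1 => [|i ij]; rewrite /node_ind.
  by rewrite eqxx mulr1 addr0.
by rewrite nth_uniq ?undup_uniq ?ltn_node // (inj_eq val_inj) (negbTE ij) mulr0.
Qed.

Lemma potential_ones_gt0 v : (k < n)%N -> v != 0 ->
  0 < net (fun=> 1) k setT (potential v) (potential v).
Proof.
move=> kn; rewrite lt_def net_ones_ge0 andbT; apply: contraNneq => net0.
apply/eqP/matrixP => j l; rewrite ord1 mxE -potential_node.
apply: (net_ones_eq0 _ net0); first by rewrite cardsT card_ord.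
by rewrite -mem_undup mem_nth // ltn_node.
Qed.

End NetworkMatrix.

(** * Passage to the limit and spectrahedrality of the cone *)

Lemma ge0_of_gt0_shift (R : realFieldType) (a b : R) :
  (forall t, 0 < t -> 0 <= t * a + b) -> 0 <= b.
Proof.
move=> ab; rewrite leNgt; apply/negP => b0.
(* Small enough that [t * a < - b]. *)
have t0 : 0 < - b / (2 * (1 + `|a|)).
  by rewrite divr_gt0 ?oppr_gt0 // mulr_gt0 // ltr_wpDr.
have := ab _ t0; apply/negP; rewrite -ltNge -ltrBrDr sub0r.
have a1 : 0 < 1 + `|a| by rewrite ltr_wpDr.
rewrite mulrAC ltr_pdivrMr ?mulr_gt0 // ltr_pM2l ?oppr_gt0 //.
by have := ler_norm a; have := normr_ge0 a; lra.
Qed.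

Theorem theorem2p14 (R : realType) (n d : nat) (hd : (1 <= d <= n)%N) :
  spectrahedral (hyperbolicity_cone (mesym n R d) (const_mx 1%R)).
Proof.
case: d hd => // k kn.
have kT : (k <= #|[set: 'I_n]|)%N by rewrite cardsT card_ord ltnW.
exists (size (nodes n k)).-1, (@net_mx R n k); split.
- move=> i; have := net_mx_sym k (fun j => (j == i)%:R : R).
  by rewrite (bigD1 i) //= eqxx scale1r big1 ?addr0 // => j /negbTE ->; rewrite scale0r.
- exists (const_mx 1); split; first exact: net_mx_sym.
  move=> v v0; rewrite net_mx_form.
  have -> : net ((const_mx 1 : 'rV_n) 0) k setT (potential v) (potential v) =
      net (fun=> 1) k setT (potential v) (potential v).
    by apply: eq_net => // i; rewrite mxE.
  exact: potential_ones_gt0.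
apply/seteqP; split=> x /= xP.
  split=> [|v]; first exact: net_mx_sym.
  rewrite net_mx_form.
  pose N := net (fun=> 1) k setT (potential v) (potential v).
  (* The elimination needs strict inequalities, which hold at [x + t 1]; then [t] tends to 0. *)
  apply: (@ge0_of_gt0_shift _ N) => t t0.
  have e_gt0 j : (j <= k.+1)%N -> 0 < elsym (fun i => t + x 0 i) setT j.
    exact: cone_elsym_gt0.
  rewrite -net_shift (le_trans _ (net_ge _ e_gt0)) //.
  by rewrite mulr_ge0 ?sqr_ge0 // divr_ge0 ?ltW ?e_gt0.
apply: elsym_gt0_cone => // t t0.
(* A semidefinite form plus [t] times the definite form at [x = 1]. *)
have net_gt0 w : (forall q, q \notin words k setT -> w q = 0) -> (exists q, w q != 0) ->
    0 < net (fun i => t + x 0 i) k setT w w.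
  move=> w_supp [q wq].
  pose v := \col_(j < (size (nodes n k)).-1.+1) w (nth [::] (nodes n k) j).
  have wE := potentialK w_supp.
  have netE y : net y k setT w w = net y k setT (potential v) (potential v).
    by apply: eq_net => // p _; rewrite wE.
  rewrite netE net_shift ltr_wpDr //.
    by case: xP => _ /(_ v); rewrite net_mx_form.
  rewrite mulr_gt0 // potential_ones_gt0 //; apply: contraNneq wq => v0.
  by rewrite -wE -/v v0 /potential big1 // => j _; rewrite mxE mul0r.
have [|ek [w [w_supp w1 wE]]] := @net_gt0_elsym _ _ (fun i => t + x 0 i) k setT kT.
  by move=> w w_supp _; apply: net_gt0.
(* The equilibrium potential has energy [e_(k+1) / e_k > 0] with [e_k > 0]. *)
have := net_gt0 w w_supp; rewrite wE pmulr_lgt0 ?invr_gt0 //; apply.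
by exists [::]; rewrite w1 oner_eq0.
Qed.
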